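(* The permutation mechanism is $7/12$-optimal on $\mathcal{G}^+$, the class of finite loopless directed graphs in which every vertex has outdegree at least $1$. That is, for every $G\in\mathcal{G}^+$ with $\Delta(G)>0$, the vertex $i$ selected from $G$ by the permutation mechanism satisfies $\mathbb{E}[\delta^-(i,G)]\ge\frac{7}{12}\,\Delta(G)$.
   Context: Graphs are finite directed graphs $G=(N,E)$ with vertex set $N=\{1,\dots,n\}$, $n\ge 1$, and $E\subseteq\{(i,j)\in N\times N: i\ne j\}$. For $S\subseteq N$ and $i\in N$, $\delta^-_S(i)=|\{j\in S:(j,i)\in E\}|$ is the indegree of $i$ from $S$; $\delta^-(i,G)=\delta^-_N(i)$; and $\Delta(G)=\max_{i\in N}\delta^-(i,G)$. $\mathcal{G}^+$ is the set of all such graphs in which every vertex has at least one outgoing edge. A selection mechanism maps each graph to a probability distribution on its vertices (the selected vertex is drawn from this distribution). It is $\alpha$-optimal on a class $\mathcal{G}'$ of graphs if for every $G\in\mathcal{G}'$ with $\Delta(G)>0$ the expected indegree of the selected vertex is at least $\alpha\,\Delta(G)$. Permutation mechanism. On input $G=(N,E)$ with $|N|=n$: choose a permutation $(\pi_1,\dots,\pi_n)$ of $N$ uniformly at random, and write $\pi_{<j}=\{\pi_1,\dots,\pi_{j-1}\}$. Set $c:=\pi_1$ and $d:=0$. For $j=2,\dots,n$ in this order: if $\delta^-_{\pi_{<j}\setminus\{c\}}(\pi_j)\ge d$, then set $c:=\pi_j$ and $d:=\delta^-_{\pi_{<j}}(\pi_j)$ (otherwise leave $c,d$ unchanged). Return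 $c$. *)

(* Defs.v *)
From HB Require Import structures.
From mathcomp Require Import all_boot all_order all_algebra all_fingroup.

Set Implicit Arguments.
Unset Strict Implicit.
Unset Printing Implicit Defensive.

Import Order.TTheory GRing.Theory Num.Theory.

Local Open Scope nat_scope.

(* Vertices are numbered from 0.  Everything below that needs a nonempty vertex
   set is stated for [digraph n.+1]. *)
Record digraph (n : nat) := Digraph {
  edges : {set 'I_n * 'I_n};
  loopless : forall i : 'I_n, (i, i) \notin edges
}.

Section Degrees.

Variables (n : nat) (G : digraph n).

Definition indeg_from (S : {set 'I_n}) (i : 'I_n) : nat :=
  #|[set j in S | (j, i) \in edges G]|.

Definition indeg (i : 'I_n) : nat := indeg_from [set: 'I_n] i.

Definition max_indeg : nat := \max_(i < n) indeg i.

End Degrees.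

Definition digraph_class := forall n : nat, digraph n.+1 -> Prop.

Definition outdeg_pos : digraph_class :=
  fun n G => forall i : 'I_n.+1, exists j : 'I_n.+1, (i, j) \in edges G.

Section Mechanisms.

Local Open Scope ring_scope.

Variable R : realFieldType.

Record distribution (T : finType) := Distribution {
  prob :> {ffun T -> R};
  prob_ge0 : forall x, 0 <= prob x;
  prob_sum1 : \sum_x prob x = 1
}.

Definition expectation (T : finType) (p : distribution T) (X : T -> R) : R :=
  \sum_x p x * X x.

Definition selection_mechanism :=
  forall n : nat, digraph n.+1 -> distribution 'I_n.+1.

Definition optimal_on (C : digraph_class) (f : selection_mechanism)
    (alpha : R) : Prop :=
  forall (n : nat) (G : digraph n.+1), C n G -> (0 < max_indeg G)%N ->
    alpha * (max_indeg G)%:R <= expectation (f n G) (fun i => (indeg G i)%:R).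

(* The law of [X s] for [s] drawn uniformly from [S]; the argument [s0] of
   [uniform_law] below only witnesses that [S] is nonempty. *)
Definition uniform_law_fun (S T : finType) (X : S -> T) : {ffun T -> R} :=
  [ffun x => #|[set s | X s == x]|%:R / #|S|%:R].

Lemma uniform_law_ge0 (S T : finType) (X : S -> T) x :
  0 <= uniform_law_fun X x.
Proof. by rewrite ffunE divr_ge0 ?ler0n. Qed.

Lemma uniform_law_sum1 (S T : finType) (s0 : S) (X : S -> T) :
  \sum_x uniform_law_fun X x = 1.
Proof.
under eq_bigr do rewrite ffunE.
rewrite -mulr_suml -natr_sum.
have -> : (\sum_x #|[set s | X s == x]| = #|S|)%N.
  rewrite -sum1_card (partition_big X predT) //=.
  apply: eq_bigr => x _; rewrite sum1dep_card.
  by apply: eq_card => s; rewrite !inE.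
by rewrite divff // pnatr_eq0 -lt0n; apply/card_gt0P; exists s0.
Qed.

Definition uniform_law (S T : finType) (s0 : S) (X : S -> T) : distribution T :=
  Distribution (uniform_law_ge0 X) (uniform_law_sum1 s0 X).

End Mechanisms.

Section PermutationMechanism.

Variables (n : nat) (G : digraph n.+1) (pi : 'S_n.+1).

(* [pi j] is the vertex in position [j], positions being numbered from 0. *)
Definition before (j : 'I_n.+1) : {set 'I_n.+1} :=
  [set pi k | k : 'I_n.+1 & k < j].

(* The state is the pair (current candidate, recorded indegree). *)
Definition permutation_step (cd : 'I_n.+1 * nat) (j : 'I_n.+1) : 'I_n.+1 * nat :=
  let: (c, d) := cd in
  if d <= indeg_from G (before j :\ c) (pi j)
  then (pi j, indeg_from G (before j) (pi j))
  else (c, d).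

Definition permutation_select : 'I_n.+1 :=
  (foldl permutation_step (pi ord0, 0) [seq j : 'I_n.+1 <- enum 'I_n.+1 | 0 < j]).1.

End PermutationMechanism.

Definition permutation_mechanism (R : realFieldType) : selection_mechanism R :=
  fun n G => uniform_law R (1%g : 'S_n.+1) (permutation_select G).

(* Main.v *)
(* Write [d] for the largest indegree and fix a vertex [v] attaining it.  If
   [d = 1], then counting edges shows that every indegree is 1.  If [d >= 2], draw
   the order [s] of the other vertices first and insert [v] at a uniform position [p].
   Let [y] be the largest indegree from preceding vertices in [s] without [v].  The
   selected vertex always has indegree at least [y], and it is [v] as soon as more
   than [y] in-neighbours of [v] come before [p].  So the expected loss given [s] is
   at most [(d - y) * T], where [T] is the proportion of positions preceded by at
   most [y] in-neighbours.  At least [d - y] in-neighbours lie at or beyond [T], so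
   averaging over pairs of in-neighbours at relative positions [P < Q] in [s] gives
   [(d - y) * T <= d/2 * mean of max (2 P) Q], however [y] depends on [s].  For a
   uniform pair that maximum has expectation at most 5/6, so the loss is at most
   5/12 of [d]. *)

Require Import Defs.
From HB Require Import structures.
From mathcomp Require Import all_boot all_order all_algebra all_fingroup.
From mathcomp Require Import zify.

Set Implicit Arguments.
Unset Strict Implicit.
Unset Printing Implicit Defensive.

Import Order.TTheory GRing.Theory Num.Theory.
Local Open Scope ring_scope.
Local Open Scope nat_scope.

(** * Weights of pairs of positions *)

(* For [a != b] this is the maximum over [t] of [t * ((t <= a.+1) + (t <= b.+1))]. *)
Definition pair_weight (a b : nat) : nat :=
  (a != b) * maxn (2 * minn a.+1 b.+1) (maxn a.+1 b.+1).

Lemma pair_weightC (a b : nat) : pair_weight a b = pair_weight b a.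
Proof. by rewrite /pair_weight eq_sym minnC maxnC; congr (_ * _); lia. Qed.

(** Once the subtraction is not truncated, with [x] for [2 * m + 1 - q], a step adds [4 * (x + 1)],
    which is [(x + 2) ^ 2 - x ^ 2]. *)
Lemma sum_excess_le (q m : nat) :
  4 * (\sum_(i < m) (2 * i.+1 - q)) <= (2 * m + 1 - q) ^ 2.
Proof.
elim: m => [|m IHm]; first by rewrite big_ord0 muln0.
rewrite big_ord_recr /= mulnDr.
have [le_mq|lt_qm] := leqP (2 * m.+1) q.
  have -> : 2 * m.+1 - q = 0 by lia.
  by rewrite muln0 addn0 (leq_trans IHm) // leq_exp2r //; lia.
have -> : 2 * m.+1 + 1 - q = (2 * m + 1 - q) + 2 by lia.
have -> : 2 * m.+1 - q = (2 * m + 1 - q) + 1 by lia.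
move: IHm; set d := 2 * m + 1 - q; set S := bigop _ _ _ => IHm.
by rewrite sqrnD; lia.
Qed.

(** Discrete form of the bound 5/6 on the mean of max (2 P) Q: there are [n * n.-1] ordered pairs of
    distinct positions, and positions are scaled by [n.+1]. *)
Lemma sum_pair_weight_le (n : nat) :
  6 * (\sum_(a < n) \sum_(b < n) pair_weight a b) <= 5 * (n.+1 * (n * n.-1)).
Proof.
elim: n => [|n IHn]; first by rewrite big_ord0.
rewrite big_ord_recr /=.
under eq_bigr do rewrite big_ord_recr /=.
rewrite big_split /= big_ord_recr /= [pair_weight n n]/pair_weight eqxx addn0.
under [X in _ + X]eq_bigr do rewrite pair_weightC.
set s := \sum_(i < n) pair_weight i n.
(* The new index adds [12 * s] on the left and [15 * (n * n.+1)] on the right. *)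
suff: 4 * s <= 4 * (n * n.+1) + n ^ 2.
  move: IHn; set X := \sum_(i < n) _ => IHn le_s.
  have nn : n * n.-1 + n = n * n by case: (n) => [|m] //=; rewrite -mulnSr.
  have : n.+1 * (n * n.-1) + 3 * (n * n.+1) = n.+2 * (n.+1 * n) by nia.
  by nia.
(* For [i < n] the weight is the larger of [2 * i.+1] and [n.+1], that is [n.+1] plus a truncated
   excess. *)
have <- : \sum_(i < n) (2 * i.+1 - n.+1) + n * n.+1 = s.
  rewrite -[n in n * _]card_ord -sum_nat_const -big_split /=.
  by apply: eq_bigr => i _; rewrite /pair_weight; have := ltn_ord i; lia.
have := sum_excess_le n.+1 n.
rewrite (_ : 2 * n + 1 - n.+1 = n); last by lia.
by rewrite mulnDr addnC leq_add2l.
Qed.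

Lemma pair_weight_ge (t a b : nat) :
  a != b -> t * ((t <= a.+1) + (t <= b.+1)) <= pair_weight a b.
Proof.
rewrite /pair_weight => ->; rewrite mul1n.
by have [] := leqP t a.+1; have [] := leqP t b.+1; lia.
Qed.

(** * Slots preceded by few in-neighbours *)

Lemma sum_off_diagonal (T : finType) (B : {set T}) (a : T) (m : nat) :
  a \in B -> \sum_(b in B) (a != b) * m = #|B|.-1 * m.
Proof.
move=> aB; rewrite (cardsD1 a) aB /= -sum_nat_const.
rewrite (bigD1 a) //= eqxx add0n; apply: eq_big => b; first by rewrite !inE andbC.
by case/andP=> _; rewrite eq_sym => ->; rewrite mul1n.
Qed.

(** The slots counted form an initial segment of length [t], and at least [#|B| - y] elements [a] of
    [B] satisfy [t <= a.+1]. Summing over ordered pairs of distinct elements counts each such [a]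
    exactly [2 * #|B|.-1] times. *)
Lemma low_slots_le_pair_weight (n y : nat) (B : {set 'I_n}) :
  2 * #|B|.-1 *
    (#|[set p : 'I_n.+1 | #|[set k in B | k < p]| <= y]| * (#|B| - y)) <=
  \sum_(a in B) \sum_(b in B) pair_weight a b.
Proof.
set S := [set p | _]; set t := #|S|.
have t_le : #|B| - y <= \sum_(a in B) (t <= a.+1).
  have [t0|t_gt0] := posnP t.
    by rewrite t0 sum1_card leq_subr.
  have t1E : (inord t.-1 : 'I_n.+1) = t.-1 :> nat.
    by rewrite inordK // prednK //; have := max_card (mem S); rewrite card_ord.
  (* [S] is closed downwards: if it missed [t.-1], its [t] elements would all lie below [t.-1]. *)
  have : inord t.-1 \in S.
    apply/negPn/negP => notS; suff : t <= t.-1 by lia.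
    have le_tn : t.-1 <= n.+1 by rewrite -t1E ltnW ?ltn_ord.
    have winj : injective (widen_ord le_tn) by move=> a b /(congr1 val)/= /val_inj.
    rewrite -[X in _ <= X]card_ord -(card_imset _ winj).
    apply/subset_leq_card/subsetP => p; rewrite inE => le_y.
    have lt_pt : p < t.-1.
      rewrite ltnNge; apply: contra notS => le_tp; rewrite inE t1E.
      apply: leq_trans le_y; apply/subset_leq_card/subsetP => k.
      by rewrite !inE => /andP[-> /leq_trans]; apply.
    by apply/imsetP; exists (Ordinal lt_pt) => //; apply: val_inj.
  rewrite inE t1E => le_y.
  rewrite leq_subLR; apply: leq_trans (leq_add le_y (leqnn _)).
  rewrite -sum1_card -(sum1dep_card) big_mkcondr -big_split /=.
  by rewrite leq_sum // => a _; case: ltnP; case: leqP; lia.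
apply: leq_trans (_ : 2 * #|B|.-1 * (t * \sum_(a in B) (t <= a.+1)) <= _).
  by rewrite !leq_mul2l t_le !orbT.
have -> : 2 * #|B|.-1 * (t * \sum_(a in B) (t <= a.+1)) =
  \sum_(a in B) \sum_(b in B) (a != b) * (t * ((t <= a.+1) + (t <= b.+1))).
  pose F (a : 'I_n) : nat := t * (t <= a.+1).
  have E1 : \sum_(a in B) \sum_(b in B) (a != b) * F a = #|B|.-1 * \sum_(a in B) F a.
    by rewrite big_distrr; apply: eq_bigr => a aB; rewrite sum_off_diagonal.
  transitivity (\sum_(a in B) \sum_(b in B) ((a != b) * F a + (b != a) * F b)).
    under [RHS]eq_bigr do rewrite big_split.
    rewrite big_split /= [X in _ = _ + X]exchange_big /= E1 -big_distrr /=; lia.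
  apply: eq_bigr => a _; apply: eq_bigr => b _.
  by rewrite [b == a]eq_sym /F -mulnDr -mulnDr.
apply: leq_sum => a _; apply: leq_sum => b _.
have [<-|ne_ab] := eqVneq a b; first by [].
by rewrite mul1n pair_weight_ge.
Qed.

(** * Averaging over uniform permutations *)

(** The symmetric group is 2-transitive: translation by some [u] with [u a = c] and [u b = d]
    matches the two sets. *)
Lemma card_perm_pair_const (T : finType) (A : {set T}) (a b c d : T) :
  a != b -> c != d ->
  #|[set s : {perm T} | (s a \in A) && (s b \in A)]| =
  #|[set s : {perm T} | (s c \in A) && (s d \in A)]|.
Proof.
move=> ne_ab ne_cd.
pose u : {perm T} := (tperm a c * tperm (tperm a c b) d)%g.
have ua : u a = c.
  by rewrite permM tpermL tpermD // ?[d == _]eq_sym // -{2}[c](tpermL a) (inj_eq perm_inj) eq_sym.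
have ub : u b = d by rewrite permM tpermL.
rewrite -!sum1dep_card (reindex_inj (mulgI u)) /=.
by apply: eq_bigl => s; rewrite permM ua permM ub.
Qed.

Lemma sum_perm_pair_weight (n : nat) (A : {set 'I_n}) :
  n * n.-1 * (\sum_(s : 'S_n) \sum_(a in s @^-1: A) \sum_(b in s @^-1: A)
    pair_weight a b) =
  n`! * (#|A| * #|A|.-1) * \sum_(a < n) \sum_(b < n) pair_weight a b.
Proof.
pose N (a b : 'I_n) := #|[set s : 'S_n | (s a \in A) && (s b \in A)]|.
have pairE (f : 'I_n -> 'I_n -> nat) :
    \sum_(s : 'S_n) \sum_(a in s @^-1: A) \sum_(b in s @^-1: A) f a b =
    \sum_a \sum_b f a b * N a b.
  transitivity (\sum_(s : 'S_n) \sum_a \sum_b f a b * ((s a \in A) && (s b \in A))).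
    apply: eq_bigr => s _; rewrite big_mkcond; apply: eq_bigr => a _ /=.
    rewrite inE; case: (s a \in A) => /=; last first.
      by rewrite big1 // => b _; rewrite muln0.
    rewrite big_mkcond; apply: eq_bigr => b _ /=.
    by rewrite inE; case: (s b \in A); rewrite ?muln0 ?muln1.
  rewrite exchange_big; apply: eq_bigr => a _ /=.
  rewrite exchange_big; apply: eq_bigr => b _ /=.
  rewrite -big_distrr /=; congr (_ * _); rewrite /N -sum1dep_card [RHS]big_mkcond /=.
  by apply: eq_bigr => s _; case: ifP.
have [c Nc] : exists c, forall a b, a != b -> N a b = c.
  case: (pickP (fun ab : 'I_n * 'I_n => ab.1 != ab.2)) => [[c d] /= ne_cd | no].
    by exists (N c d) => a b ne_ab; apply: card_perm_pair_const.
  by exists 0 => a b; have /= -> := no (a, b).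
have sumN (f : 'I_n -> 'I_n -> nat) :
    (forall a, f a a = 0) -> \sum_a \sum_b f a b * N a b = c * \sum_a \sum_b f a b.
  move=> f0; rewrite big_distrr; apply: eq_bigr => a _ /=.
  rewrite big_distrr; apply: eq_bigr => b _ /=; rewrite mulnC.
  by have [->|/Nc ->] := eqVneq a b; rewrite ?f0 ?muln0.
rewrite pairE sumN; last by move=> a; rewrite /pair_weight eqxx.
rewrite mulnA; congr (_ * _).
(* The constant [c] is found by double counting, with the indicator of [a != b] in place of
   [pair_weight]. *)
transitivity (c * \sum_(a < n) \sum_(b < n) (a != b) * 1).
  rewrite mulnC; congr (_ * _).
  rewrite (eq_bigr (fun=> n.-1)) => [|a _]; first by rewrite big_const_ord iter_addn_0 mulnC.
  rewrite (eq_bigl (fun b => b \in [set: 'I_n])) => [|b]; last by rewrite in_setT.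
  by rewrite sum_off_diagonal ?inE // cardsT card_ord muln1.
rewrite -sumN => [|a]; last by rewrite eqxx.
rewrite -pairE (eq_bigr (fun=> #|A| * #|A|.-1)) => [|s _].
  by rewrite sum_nat_const card_Sn.
have cardA : #|s @^-1: A| = #|A|.
  by rewrite -[s]invgK preim_permV card_imset //; apply: perm_inj.
rewrite -cardA -sum_nat_const; apply: eq_bigr => a As.
by rewrite sum_off_diagonal ?muln1.
Qed.

(** * Invariants of the permutation mechanism *)

Section Mechanism.

Variables (n : nat) (G : digraph n.+1).
Implicit Types (pi : 'S_n.+1) (j : 'I_n.+1).

(** Invariant principle for the loop: [P k] concerns the state once position [k] has been
    handled. *)
Lemma permutation_select_ind pi (P : nat -> 'I_n.+1 * nat -> Prop) :
  P 0 (pi ord0, 0) ->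
  (forall j k cd, j = k.+1 :> nat -> P k cd -> P k.+1 (permutation_step G pi cd j)) ->
  exists cd, P n cd /\ permutation_select G pi = cd.1.
Proof.
move=> P0 PS; rewrite /permutation_select.
set l := [seq _ <- _ | _].
have -> : l = [seq inord i | i <- iota 1 n].
  apply: (inj_map val_inj); rewrite -map_comp.
  rewrite (eq_in_map _ id _).1 ?map_id; last first.
    by move=> i; rewrite mem_iota => /andP[_ lt_i] /=; rewrite inordK.
  rewrite /l enum_ordSl /= (eq_in_filter (a2 := predT)) ?filter_predT.
    by rewrite -map_comp (eq_map (g := addn 1 \o val)) // map_comp val_enum_ord -iotaDl.
  by move=> _ /mapP[i _ ->]; rewrite lift0.
set st := foldl _ _ _; exists st; split=> //; rewrite {}/st.
suff H k : k <= n -> P k (foldl (permutation_step G pi) (pi ord0, 0)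
    [seq inord i | i <- iota 1 k]) by exact: H.
elim: k => [|k IHk] lt_kn //.
rewrite -[X in iota _ X]addn1 iotaD map_cat foldl_cat /= add1n.
by apply: PS; [rewrite inordK | apply/IHk/ltnW].
Qed.

Lemma mem_before pi j k : (pi k \in before pi j) = (k < j).
Proof. by rewrite /before (mem_imset _ _ (@perm_inj _ pi)) inE. Qed.

Lemma before_ord0 pi j : j = 0 :> nat -> before pi j = set0.
Proof.
by move=> j0; apply/setP => u; rewrite -[u](permKV pi) mem_before j0 inE.
Qed.

Lemma indeg_from_beforeD pi j (i : 'I_n.+1) (D : {set 'I_n.+1}) :
  indeg_from G (before pi j :\: D) i =
  #|[set k : 'I_n.+1 | [&& k < j, pi k \notin D & (pi k, i) \in edges G]]|.
Proof.
rewrite /indeg_from -[RHS](card_imset _ (@perm_inj _ pi)); apply: eq_card => u.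
rewrite -[u](permKV pi) (mem_imset _ _ (@perm_inj _ pi)) inE in_setD mem_before.
by rewrite inE andbCA andbA andbAC -andbA.
Qed.

Lemma indeg_from_le (D : {set 'I_n.+1}) (i : 'I_n.+1) : indeg_from G D i <= indeg G i.
Proof. by apply/subset_leq_card/subsetP => k; rewrite !inE => /andP[]. Qed.

Lemma indeg_fromD1 (D : {set 'I_n.+1}) (c i : 'I_n.+1) :
  indeg_from G D i <= (indeg_from G (D :\ c) i).+1.
Proof.
rewrite -[X in _ <= X]add1n -[X in X + _](cards1 c).
apply: leq_trans (leq_card_setU _ _).
apply/subset_leq_card/subsetP => k; rewrite !inE => /andP[-> ->].
by case: (k == c).
Qed.

Lemma indeg_from_D1le (D : {set 'I_n.+1}) (c i : 'I_n.+1) :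
  indeg_from G (D :\ c) i <= indeg_from G D i.
Proof.
by apply/subset_leq_card/subsetP => k; rewrite !inE -andbA => /and3P[_ -> ->].
Qed.

(** Invariant: the recorded value is at most the indegree of the candidate and at least every
    indegree from preceding vertices met so far. *)
Lemma permutation_select_ge pi j :
  indeg_from G (before pi j) (pi j) <= indeg G (permutation_select G pi).
Proof.
pose b k := indeg_from G (before pi k) (pi k).
pose P k (cd : 'I_n.+1 * nat) := cd.2 <= indeg G cd.1 /\
  forall i : 'I_n.+1, i <= k -> b i <= cd.2.
have [|i k [c d] ik [le_d le_b]|[c d] [[le_d le_b] ->]] :=
    @permutation_select_ind pi P.
- split=> // i; rewrite leqn0 => /eqP i0; rewrite /b.
  by rewrite leqn0 cards_eq0 -subset0 before_ord0 //; apply/subsetP => u; rewrite !inE.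
- rewrite /P /permutation_step; have [le_new|lt_new] := leqP d _; split=> //=.
  + exact: indeg_from_le.
  + move=> i'; rewrite leq_eqVlt -ik => /orP[/eqP/val_inj -> //|].
    rewrite ik ltnS => /le_b/leq_trans; apply; apply: leq_trans le_new _.
    exact: indeg_from_D1le.
  + move=> i'; rewrite leq_eqVlt -ik => /orP[/eqP/val_inj ->|].
      (* A rejected vertex has fewer than [d] preceding in-neighbours other than [c], hence at most
         [d] in all. *)
      by apply: leq_trans (indeg_fromD1 _ c _) lt_new.
    by rewrite ik ltnS => /le_b.
- by apply: leq_trans (le_b j _) le_d; rewrite -ltnS.
Qed.

(** The recorded value stays at most [y] before [p]. Then [pi p] is accepted, even if one
    in-neighbour is discounted, and records more than any later vertex reaches without counting
    [pi p]. *)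
Lemma permutation_select_eq pi (p : 'I_n.+1) (y : nat) :
  y < indeg_from G (before pi p) (pi p) ->
  (forall j, j != p -> indeg_from G (before pi j :\ pi p) (pi j) <= y) ->
  permutation_select G pi = pi p.
Proof.
move=> lt_yp le_y.
pose P k (cd : 'I_n.+1 * nat) :=
  if p <= k then cd = (pi p, indeg_from G (before pi p) (pi p)) else cd.2 <= y.
have [|i k [c d] ik|cd [+ ->]] := @permutation_select_ind pi P.
- rewrite /P leqn0; case: eqP => // p0; move: lt_yp.
  rewrite ltnNge; case/negP; apply: leq_trans (leq0n y).
  by rewrite leqn0 cards_eq0 -subset0 before_ord0 //; apply/subsetP => u; rewrite !inE.
- rewrite /P -ik; have [lt_pi|lt_ip|/val_inj eq_pi] := ltngtP p i.
  + rewrite ik ltnS in lt_pi; rewrite lt_pi => -[-> ->] /=.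
    rewrite leqNgt; case: ifP => // /negP[]; apply: leq_ltn_trans lt_yp.
    by apply: le_y; apply: contraTneq lt_pi => <-; rewrite ik -ltnNge.
  + rewrite leqNgt (ltn_trans _ lt_ip) ?ik //= => le_dy.
    case: ifP => //= _; have := le_y i; rewrite neq_ltn lt_ip => /(_ isT).
    (* As [i < p], excluding [pi p] removes nothing from the preceding vertices. *)
    apply: leq_trans; rewrite /indeg_from; apply/subset_leq_card/subsetP => u.
    rewrite -[u](permKV pi) !inE mem_before (inj_eq perm_inj) => /andP[lt_ui ->].
    by rewrite lt_ui !andbT; apply: contraTneq lt_ui => ->; rewrite -leqNgt ltnW.
  + rewrite eq_pi in lt_yp *; rewrite ik ltnNge leqnn /= => le_dy; case: leqP => // lt_d.
    have := leq_ltn_trans le_dy lt_yp; rewrite ltnNge => /negP[].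
    by apply: leq_trans (indeg_fromD1 _ c _) lt_d.
- by rewrite /P -ltnS ltn_ord => ->.
Qed.

End Mechanism.

(** * Inserting a vertex into an order of the others *)

Lemma sum_lift_perm (n : nat) (v : 'I_n.+1) (f : 'S_n.+1 -> nat) :
  \sum_pi f pi = \sum_(s : 'S_n) \sum_(p : 'I_n.+1) f (lift_perm p v s).
Proof.
pose h (sp : 'S_n * 'I_n.+1) := lift_perm sp.2 v sp.1.
have inj_h : injective h.
  move=> [s p] [s' p'] /= eq_h; have eq_p : p = p'.
    by apply: (@perm_inj _ (h (s', p'))); rewrite -{1}eq_h /h !lift_perm_id.
  rewrite -eq_p in eq_h *; congr (_, _); apply/permP => k; apply: (@lift_inj _ v).
  by rewrite -!(lift_perm_lift p v) -/(h (s, p)) eq_h.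
rewrite pair_bigA (reindex h) //; apply: onW_bij; apply: inj_card_bij inj_h _.
by rewrite card_prod card_ord !card_Sn mulnC.
Qed.

Section Insertion.

Variables (n : nat) (G : digraph n.+1) (v : 'I_n.+1).
Implicit Types (s : 'S_n) (p : 'I_n.+1).

Definition in_neighbours : {set 'I_n} := [set a | (lift v a, v) \in edges G].

(** The [y] of the proof idea, which depends on the order [s] alone and not on where [v] is
    inserted. *)
Definition back_indeg s : nat :=
  \max_(j < n) #|[set k : 'I_n | (k < j) && ((lift v (s k), lift v (s j)) \in edges G)]|.

Lemma card_in_neighbours : #|in_neighbours| = indeg G v.
Proof.
rewrite -(card_imset _ (@lift_inj _ v)); apply: eq_card => u; rewrite !inE /=.
have [a|] := unliftP v u => ->; first by rewrite (mem_imset _ _ (@lift_inj _ v)) inE.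
by rewrite (negPf (loopless G v)); apply/imsetP => -[a _ /eqP]; rewrite (negPf (neq_lift _ _)).
Qed.

Lemma ltn_lift (p : 'I_n.+1) (k : 'I_n) : (lift p k < p) = (k < p).
Proof. by rewrite /= /bump; case: leqP => ?; lia. Qed.

Lemma ltn_lift2 (p : 'I_n.+1) (j k : 'I_n) : (lift p k < lift p j) = (k < j).
Proof. by rewrite /= /bump; do 2!case: leqP => ?; lia. Qed.

Lemma indeg_from_inserted s p :
  indeg_from G (before (lift_perm p v s) p) v =
  #|[set k in s @^-1: in_neighbours | k < p]|.
Proof.
rewrite -[before _ _]setD0 indeg_from_beforeD -[RHS](card_imset _ (@lift_inj _ p)).
apply: eq_card => k; rewrite inE in_set0 /=.
have [a|] := unliftP p k => ->.
  by rewrite (mem_imset _ _ (@lift_inj _ p)) !inE ltn_lift lift_perm_lift andbC.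
rewrite ltnn; apply/esym/imsetP => -[a _ /eqP]; rewrite (negPf (neq_lift _ _)) //.
Qed.

Lemma indeg_from_lifted s p (j : 'I_n) (pi := lift_perm p v s) :
  indeg_from G (before pi (lift p j) :\ v) (pi (lift p j)) =
  #|[set k : 'I_n | (k < j) && ((lift v (s k), lift v (s j)) \in edges G)]|.
Proof.
rewrite indeg_from_beforeD -[RHS](card_imset _ (@lift_inj _ p)) /pi lift_perm_lift.
apply: eq_card => k; rewrite inE in_set1.
have [a|] := unliftP p k => ->.
  rewrite (mem_imset _ _ (@lift_inj _ p)) !inE ltn_lift2 lift_perm_lift.
  by rewrite eq_sym neq_lift.
rewrite lift_perm_id eqxx andbF; apply/esym/imsetP => -[a _ /eqP].
by rewrite (negPf (neq_lift _ _)).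
Qed.

(** With more than [back_indeg s] in-neighbours before it, [v] is selected and nothing is lost;
    otherwise the selected vertex still has indegree at least [back_indeg s]. *)
Lemma insertion_loss s p :
  indeg G v <= indeg G (permutation_select G (lift_perm p v s)) +
    (#|[set k in s @^-1: in_neighbours | k < p]| <= back_indeg s) *
      (indeg G v - back_indeg s).
Proof.
set pi := lift_perm p v s; have pi_p : pi p = v by rewrite /pi lift_perm_id.
have [_|lt_y] /= := leqP #|_| (back_indeg s).
  suff: back_indeg s <= indeg G (permutation_select G pi) by rewrite mul1n; lia.
  apply/bigmax_leqP => j _; rewrite -(indeg_from_lifted s p).
  exact: leq_trans (indeg_from_D1le _ _ _ _) (permutation_select_ge _ _ _).
rewrite mul0n addn0 (@permutation_select_eq _ _ _ p (back_indeg s)) ?pi_p //.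
  by rewrite indeg_from_inserted.
move=> j; have [a|] := unliftP p j => ->; last by rewrite eqxx.
by rewrite indeg_from_lifted => _; apply: (leq_bigmax a).
Qed.

Lemma sum_insertion_loss :
  1 < indeg G v ->
  12 * (\sum_(s : 'S_n) #|[set p : 'I_n.+1 |
     #|[set k in s @^-1: in_neighbours | k < p]| <= back_indeg s]| *
     (indeg G v - back_indeg s)) <= 5 * (indeg G v * n.+1`!).
Proof.
set L := \sum_(s | _) _; rewrite -card_in_neighbours; set D := #|_| => D_gt1.
have n_gt1 : 1 < n.
  by apply: leq_trans D_gt1 _; rewrite -[X in _ <= X]card_ord max_card.
set X := \sum_(s : 'S_n) \sum_(a in s @^-1: in_neighbours)
  \sum_(b in s @^-1: in_neighbours) pair_weight a b.
have le_LX : 2 * D.-1 * L <= X.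
  rewrite /L big_distrr; apply: leq_sum => s _ /=.
  have cardD : #|s @^-1: in_neighbours| = D.
    by rewrite -[s]invgK preim_permV card_imset //; apply: perm_inj.
  by rewrite -card_in_neighbours -/D -cardD low_slots_le_pair_weight.
have XE := sum_perm_pair_weight in_neighbours; rewrite -/X -/D in XE.
have := sum_pair_weight_le n; set S := \sum_(a < n) _ in XE * => le_S.
(* This factor can be cancelled because [v] has at least two in-neighbours. *)
have gt0 : 0 < n * n.-1 * D.-1 by rewrite !muln_gt0; lia.
rewrite -(leq_pmul2l gt0).
apply: (@leq_trans (6 * (n * n.-1 * X))).
  apply: leq_trans (_ : 6 * (n * n.-1 * (2 * D.-1 * L)) <= _); first by lia.
  by rewrite !leq_mul2l le_LX !orbT.
rewrite XE; apply: leq_trans (_ : n`! * (D * D.-1) * (6 * S) <= _); first by lia.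
apply: leq_trans (_ : n`! * (D * D.-1) * (5 * (n.+1 * (n * n.-1))) <= _).
  by rewrite leq_mul2l le_S orbT.
by rewrite factS; lia.
Qed.

End Insertion.

(** * Edge counting and the final bound *)

Lemma sum_indeg (n : nat) (G : digraph n) : \sum_i indeg G i = #|edges G|.
Proof.
rewrite -sum1_card (partition_big snd predT) //=; apply: eq_bigr => i _.
rewrite /indeg /indeg_from sum1dep_card -[LHS](card_imset _ (f := fun j => (j, i))).
  apply: eq_card => -[j k]; rewrite !inE; apply/imsetP/andP => [[u]|[/= e /eqP eq_ki]].
    by rewrite !inE /= => e [-> ->].
  by rewrite eq_ki in e *; exists j; rewrite ?inE.
by move=> j j' [].
Qed.

(** Outgoing edges give at least [n.+1] edges in all, whereas a vertex of indegree 0 would leave at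
    most [n]. *)
Lemma indeg_outdeg_pos (n : nat) (G : digraph n.+1) (i : 'I_n.+1) :
  outdeg_pos G -> max_indeg G = 1 -> indeg G i = 1.
Proof.
move=> Gpos max1.
have le1 j : indeg G j <= 1 by rewrite -max1 /max_indeg leq_bigmax.
have : n.+1 <= \sum_j indeg G j.
  rewrite sum_indeg -[X in X <= _]card_ord.
  have /fin_all_exists [f fP] := Gpos.
  rewrite -(card_imset predT (f := fun j => (j, f j))); last by move=> j j' [].
  by apply/subset_leq_card/subsetP => _ /imsetP[j _ ->].
rewrite (bigD1 i) //=; set S := \sum_(j | _) _ => le_nS.
have : S <= n.
  apply: leq_trans (_ : \sum_(j | j != i) 1 <= _); first exact: leq_sum.
  by rewrite sum1_card cardC1 card_ord.
by have := le1 i; move: (indeg G i) S le_nS => d S; lia.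
Qed.

Lemma sum_permutation_select (n : nat) (G : digraph n.+1) :
  outdeg_pos G -> 0 < max_indeg G ->
  7 * (max_indeg G * n.+1`!) <=
  12 * \sum_(pi : 'S_n.+1) indeg G (permutation_select G pi).
Proof.
move=> Gpos; rewrite leq_eqVlt => /orP[/eqP/esym max1 | max_gt1].
  rewrite (eq_bigr (fun=> 1)) => [|pi _]; last exact: indeg_outdeg_pos.
  by rewrite sum_nat_const card_Sn max1; lia.
have [|v] := @bigop.eq_bigmax _ (indeg G); first by rewrite card_ord.
rewrite -/(max_indeg G) => maxE.
rewrite maxE in max_gt1 *.
have := sum_insertion_loss max_gt1; set L := \sum_(s | _) _ => le_L.
(* The total loss is at most [L], hence at most 5/12 of the optimum summed over all permutations. *)
suff: indeg G v * n.+1`! <=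
    \sum_(pi : 'S_n.+1) indeg G (permutation_select G pi) + L by lia.
rewrite (sum_lift_perm v) -big_split /=.
apply: leq_trans (_ : \sum_(s : 'S_n) \sum_(p : 'I_n.+1) indeg G v <= _).
  by rewrite !sum_nat_const card_ord card_Sn factS; lia.
apply: leq_sum => s _.
rewrite -sum1dep_card big_distrl [X in _ <= _ + X]big_mkcond -big_split /=.
apply: leq_sum => p _; apply: leq_trans (insertion_loss G v s p) _.
by rewrite leq_add2l; case: ifP => _; rewrite ?mul0n.
Qed.

Local Close Scope nat_scope.

Theorem theorem5 (R : realFieldType) :
  optimal_on outdeg_pos (permutation_mechanism R) (7%:R / 12%:R).
Proof.
move=> n G Gpos max_gt0.
have := sum_permutation_select Gpos max_gt0; set W := bigop _ _ _ => le_W.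
have fact_gt0R : 0 < (n.+1)`!%:R :> R by rewrite ltr0n fact_gt0.
(* Grouping the permutations by the selected vertex turns the expectation into an average over
   permutations. *)
have -> : expectation (permutation_mechanism R G) (fun i => (indeg G i)%:R) =
    W%:R / (n.+1)`!%:R.
  rewrite /expectation /W (partition_big (permutation_select G) predT) //=.
  rewrite natr_sum mulr_suml; apply: eq_bigr => i _.
  rewrite ffunE card_Sn mulrAC -natrM; congr (_%:R / _).
  rewrite -sum1dep_card big_distrl /=.
  by apply: eq_bigr => s /eqP ->; rewrite mul1n.
rewrite ler_pdivlMr // -mulrA mulrAC ler_pdivrMr ?ltr0n //.
by rewrite -!natrM ler_nat [(W * _)%N]mulnC.
Qed.
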